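(* $$\sum_{\pi\in\mathcal{E}_N^{O}}q^{|\pi|}=(-q;q)_\infty^2+\frac{1}{(q;q)_\infty}-(-q;q)_\infty .$$
   Context: An overpartition is a finite non-increasing sequence of positive integers (its parts) in which the first occurrence of each number may be overlined (so for each size $t$ at most one part of size $t$ is overlined); the size of a part $t$ or $\overline{t}$ is $t$, and the weight $|\pi|$ is the sum of the sizes of the parts. The empty overpartition has weight $0$. $\mathcal{E}_N^{O}$ is the set of overpartitions (including the empty one) such that the sizes of overlined parts (if any exist) are greater than or equal to the sizes of all non-overlined parts. Here $|q|<1$ (or $q$ is a formal variable), $(a;q)_\infty=\prod_{i=0}^{\infty}(1-aq^i)$. *)

(* Defs.v *)
From HB Require Import structures.
From mathcomp Require Import all_boot all_order all_algebra.
From mathcomp Require Import all_classical all_reals all_analysis.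
From mathcomp Require Import complex.
From mathcomp Require Import showcase.summability.

Set Implicit Arguments.
Unset Strict Implicit.
Unset Printing Implicit Defensive.

Import Order.TTheory GRing.Theory Num.Theory.
Import numFieldNormedType.Exports.

Local Open Scope classical_set_scope.
Local Open Scope ring_scope.

(* A part is a pair (size, overlined?). *)
Definition part := (nat * bool)%type.
Definition part_size (p : part) : nat := p.1.
Definition overlined (p : part) : bool := p.2.

(* The [pairwise] clause says that a part preceded by a part of the same size
   is not overlined, i.e. only first occurrences may be overlined. *)
Definition is_overpartition (s : seq part) : bool :=
  [&& all (fun p => 0 < part_size p)%N s,
      sorted geq [seq part_size p | p <- s]
    & pairwise (fun p p' => (part_size p == part_size p') ==> ~~ overlined p') s].

Definition weight (s : seq part) : nat := sumn [seq part_size p | p <- s].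

Definition is_ENO (s : seq part) : bool :=
  is_overpartition s &&
  all (fun p => all (fun p' =>
    (overlined p && ~~ overlined p') ==> (part_size p' <= part_size p)%N) s) s.

Definition ENO : choiceType := {s : seq part | is_ENO s}.

(* Unordered summation: convergence of the net of finite partial sums. *)
Definition has_sum (I : choiceType) (K : numFieldType) (x : I -> K) (l : K)
    : Prop :=
  partial_sum x A @[A --> totally] --> l.

Definition qpoch_inf (K : numFieldType) (a q : K) : K :=
  lim ((\prod_(0 <= i < n) (1 - a * q ^+ i)) @[n --> \oo]).

(* Main.v *)
Require Import Defs.
From mathcomp Require Import all_boot all_order all_algebra.
From mathcomp Require Import all_classical all_reals all_analysis.
From mathcomp Require Import complex.
From mathcomp Require Import finmap ring zify.
From mathcomp Require Import showcase.summability.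

Import Order.TTheory GRing.Theory Num.Theory.
Import numFieldNormedType.Exports.
Local Open Scope ring_scope.

(* Splitting off the smallest overlined part k gives, for the overpartitions with
   an overlined part,
     sum_k q^k (-q^(k+1); q)_oo / (q; q)_k = (-q; q)_oo sum_k q^k / (q^2; q^2)_k,
   and sum_(k >= 0) q^k / (q^2; q^2)_k = (-q; q)_oo is the limit of Gauss's identity
     (-q; q)_M = sum_(m <= M) q^m (q^2; q^2)_M / ((q^2; q^2)_m (q^2; q^2)_(M - m)).
   All sums are taken over the finite sets [box N]: sizes and non-overlined
   multiplicities at most N. There they have a closed form, which is within
   O(|q|^N) of the claimed limit. The same bound at |q| gives the absolute
   convergence that the unordered sum requires. *)

(** * Overpartitions as sorted lists, and their finite boxes *)

(** In an element of E_N^O the overlined parts come first and have distinct sizes. Encoding this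
    together with the order of sizes as one transitive relation turns membership into sortedness. *)
Definition precedes (x y : part) : bool :=
  (part_size y <= part_size x)%N &&
  (overlined y ==> overlined x && (part_size y < part_size x)%N).

Lemma precedes_trans : transitive precedes.
Proof.
move=> [b y] [a x] [c z]; rewrite /precedes /=.
by case: x y z => [] [] [] //=; lia.
Qed.

(** By transitivity sortedness is a condition on all pairs, so induction on the list only has to
    compare its head with each later part. *)
Lemma is_ENOE s :
  is_ENO s = all (fun p => 0 < part_size p)%N s && sorted precedes s.
Proof.
rewrite /is_ENO /is_overpartition sorted_map !sorted_pairwise; last 2 first.
- exact: precedes_trans.
- by move=> a b c /= H1 H2; exact: leq_trans H2 H1.
rewrite -!andbA; congr (_ && _).
elim: s => //= x s <-.
pose S (p p' : part) :=
  overlined p && ~~ overlined p' ==> (part_size p' <= part_size p)%N.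
have E : all (precedes x) s =
  [&& all (fun y => part_size y <= part_size x)%N s,
     all (fun y => (part_size x == part_size y) ==> ~~ overlined y) s,
     all (S x) s & all (S^~ x) s].
  rewrite -!all_predI; apply: eq_all => -[b y]; rewrite /S /precedes /=.
  by case: x => a [] /=; case: y => //=; lia.
have -> : all (fun p => S p x && all (S p) s) s =
    all (S^~ x) s && all (fun p => all (S p) s) s.
  by rewrite -all_predI.
rewrite E andbN /= -!andbA.
by do !bool_congr.
Qed.

(* [plain N m] lists the overpartitions without overlined parts whose parts have
   size at most m and multiplicity at most N; [mixed N m] lists the elements of
   E_N^O with an overlined part whose parts have size at most m, the bound N being
   put on the multiplicities of the non-overlined parts only. *)
Fixpoint plain (N m : nat) : seq (seq part) :=
  if m is m'.+1 then
    [seq nseq j (m'.+1, false) ++ t | j <- iota 0 N.+1, t <- plain N m']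
  else [:: [::]].

Fixpoint mixed (N m : nat) : seq (seq part) :=
  if m is m'.+1 then
    mixed N m' ++ [seq (m'.+1, true) :: t | t <- mixed N m' ++ plain N m'.+1]
  else [::].

Lemma plainS N m : plain N m.+1 =
  [seq nseq j (m.+1, false) ++ t | j <- iota 0 N.+1, t <- plain N m].
Proof. by []. Qed.

Lemma mixedS N m : mixed N m.+1 =
  mixed N m ++ [seq (m.+1, true) :: t | t <- mixed N m ++ plain N m.+1].
Proof. by []. Qed.

Definition within (m : nat) (p : part) : bool := (0 < part_size p <= m)%N.

Lemma withinS m p : within m p -> within m.+1 p.
Proof. by rewrite /within => /andP[-> /= /leqW]. Qed.

Lemma plainP N m s : s \in plain N m ->
  [/\ all (within m) s, ~~ has overlined s & sorted precedes s].
Proof.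
elim: m s => [|m IH] s; first by rewrite inE => /eqP ->.
rewrite plainS.
move/allpairsPdep => [j [t /= [_ /IH[Hb Ho Hs] ->]]]; split.
- rewrite all_cat all_nseq /within /= ltnSn orbT /=.
  by apply: sub_all Hb => p /withinS.
- by rewrite has_cat has_nseq andbF.
rewrite sorted_pairwise; last exact: precedes_trans.
rewrite (sorted_pairwise precedes_trans) in Hs.
rewrite pairwise_cat Hs andbT.
apply/andP; split; last first.
  by elim: j => //= j ->; rewrite all_nseq /precedes /= leqnn orbT.
rewrite allrelC; apply/allrelP => p y Hp; rewrite mem_nseq => /andP[_ /eqP ->].
move/allP: Hb => /(_ _ Hp) /andP[_ Hm].
move/hasPn: Ho => /(_ _ Hp) /negbTE Ho.
by rewrite /precedes Ho /= (leqW Hm).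
Qed.

Lemma mixedP N m s : s \in mixed N m ->
  [/\ all (within m) s, has overlined s & sorted precedes s].
Proof.
elim: m s => [|m IH] s //=; rewrite mem_cat => /orP[/IH[Hb Ho Hs]|].
  by split=> //; apply: sub_all Hb => p /withinS.
case/mapP => t; rewrite mem_cat => /orP Ht ->.
have [Hb Hs Hp]: [/\ all (within m.+1) t, sorted precedes t
    & all (precedes (m.+1, true)) t].
  case: Ht => [/IH[Hb Ho Hs]|/(@plainP N m.+1)[Hb Ho Hs]]; split=> //.
  - by apply: sub_all Hb => p /withinS.
  - apply: sub_all Hb => p /andP[_ Hp].
    by rewrite /precedes /= (leqW Hp) ltnS Hp implybT.
  - apply/allP => p Hp; move/allP: Hb => /(_ _ Hp) /andP[_ Hm].
    move/hasPn: Ho => /(_ _ Hp) /negbTE Ho.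
    by rewrite /precedes Ho /= Hm.
split=> //=; first by rewrite /within /= ltnSn.
by rewrite (path_sortedE precedes_trans) Hp Hs.
Qed.

Lemma mem_plain N m s : (size s <= N)%N -> all (within m) s ->
  ~~ has overlined s -> sorted precedes s -> s \in plain N m.
Proof.
elim: m s => [|m IH] s Hn Hb Ho Hs.
  by case: s Hn Hb {Ho Hs} => //= -[[|a] b].
(* The leading block of parts of size [m.+1] is split off; what remains has sizes at most [m], as
   the induction requires. *)
have [j [t [Es Ht Hj]]] : exists j t, [/\ s = nseq j (m.+1, false) ++ t,
   all (within m) t & (j <= N)%N].
  elim: s Hn Hb Ho Hs {IH} => [|[a b] s IHs] /=.
    by exists 0%N, [::].
  move=> Hn /andP[/andP[/= a0 am] Hb]; rewrite negb_or => /andP[/= Hnb Ho] Hs.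
  have Hs' := path_sorted Hs.
  rewrite (negbTE Hnb) in Hs *.
  case: (ltnP a m.+1) => [lt|ge].
    exists 0%N, ((a, false) :: s); split=> //=.
    rewrite {1}/within /= a0 -ltnS lt /=.
    move: Hs; rewrite (path_sortedE precedes_trans) => /andP[Hp _].
    apply/allP => p Hps; move/allP: Hp => /(_ _ Hps) /andP[/= pa _].
    move/allP: Hb => /(_ _ Hps) /andP[p0 _].
    by rewrite /within p0 /= (leq_trans pa) // -ltnS.
  have -> : a = m.+1 by apply/eqP; rewrite eqn_leq am ge.
  have [j [t [Es Ht Hj]]] := IHs (ltnW Hn) Hb Ho Hs'.
  exists j.+1, t; split=> //=; first by rewrite Es.
  by apply: leq_trans Hn; rewrite Es size_cat size_nseq ltnS leq_addr.
rewrite plainS; apply/allpairsP; exists (j, t); split=> //.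
  by rewrite mem_iota.
rewrite Es in Hn Ho Hs; apply: IH => //.
- by apply: leq_trans Hn; rewrite size_cat leq_addl.
- by move: Ho; rewrite has_cat negb_or => /andP[].
- by move: Hs; rewrite !(sorted_pairwise precedes_trans) pairwise_cat
    => /and3P[].
Qed.

Lemma mem_mixed N m s : (size s <= N)%N -> all (within m) s ->
  has overlined s -> sorted precedes s -> s \in mixed N m.
Proof.
elim: m s => [|m IH] s Hn Hb Ho Hs.
  by case: s Hn Hb Ho {Hs} => //= -[[|a] b].
case: s Hn Hb Ho Hs => //= -[a b] s Hn /andP[/andP[/= a0 am] Hb] Ho Hs.
(* Only overlined parts can stand before an overlined part, so one overlined part anywhere forces
   the head to be overlined. *)
have b1 : b.
  case/orP: Ho => //= /hasP[p Hp Hop].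
  move: Hs; rewrite (path_sortedE precedes_trans) => /andP[/allP Hp' _].
  by move: (Hp' _ Hp); rewrite /precedes Hop /= => /and3P[].
rewrite mem_cat; apply/orP; rewrite {}b1 {b Ho} in Hs *.
have := Hs; rewrite (path_sortedE precedes_trans) => /andP[/allP Hp Hs'].
case: (ltnP a m.+1) => [lt|ge]; [left|right].
  apply: IH => //=; rewrite /within /= a0 -ltnS lt /=.
  apply/allP => p Hps; move: (Hp _ Hps) => /andP[/= pa _].
  move/allP: Hb => /(_ _ Hps) /andP[p0 _].
  by rewrite /within p0 /= (leq_trans pa) // -ltnS.
have Ea : a = m.+1 by apply/eqP; rewrite eqn_leq am ge.
rewrite Ea in Hp *; apply/mapP; exists s => //; rewrite mem_cat.
have [Ho|Ho] := boolP (has overlined s); apply/orP; [left|right]; last first.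
  by apply: (@mem_plain N m.+1) => //; apply: ltnW.
(* The tail still has an overlined part, so its own head is overlined, hence strictly smaller than
   [m.+1], and it bounds all later sizes. *)
apply: IH => //; first exact: ltnW.
case: s Hn Hb Ho Hs' Hp {Hs} => //= -[c d] s Hn /andP[/andP[/= c0 cm] Hb] Ho Hs Hp.
have d1 : d.
  case/orP: Ho => //= /hasP[p Hps Hop].
  move: Hs; rewrite (path_sortedE precedes_trans) => /andP[/allP Hp' _].
  by move: (Hp' _ Hps); rewrite /precedes Hop /= => /and3P[].
have := Hp (c, d) (mem_head _ _); rewrite /precedes d1 /= => /andP[_ cltm].
rewrite /within /= c0 -ltnS cltm /=; apply/allP => p Hps.
move: Hs; rewrite (path_sortedE precedes_trans) => /andP[/allP/(_ _ Hps) /andP[/= pc _] _].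
move/allP: Hb => /(_ _ Hps) /andP[p0 _].
by rewrite /within p0 /= (leq_trans pc).
Qed.

Lemma uniq_plain N m : uniq (plain N m).
Proof.
elim: m => // m IH; rewrite plainS; apply: allpairs_uniq; rewrite ?iota_uniq //.
have H t : t \in plain N m -> (m.+1, false) \notin t.
  move=> /plainP[/allP Hb _ _]; apply/negP => /Hb.
  by rewrite /within /= ltnn.
move=> x y /allpairsP[[j t] [_ /H Ht {x}->]] /allpairsP[[k u] /= [_ /H Hu {y}->]] /=.
(* The multiplicity is recovered by counting [(m.+1, false)], which does not occur in [t] or [u]. *)
move=> E; have Ejk : j = k.
  move/(congr1 (count_mem (m.+1, false))): E.
  by rewrite !count_cat !count_nseq /= eqxx !mul1n !(count_memPn _) ?addn0.
rewrite {}Ejk in E *; congr pair.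
by move/eqP: E; rewrite eqseq_cat // eqxx => /eqP.
Qed.

Lemma uniq_mixed N m : uniq (mixed N m).
Proof.
elim: m => //= m IH; rewrite cat_uniq IH /=; apply/andP; split.
  apply/hasPn => _ /mapP[t _ ->]; apply/negP => /mixedP[/=].
  by rewrite /within /= ltnn.
rewrite map_inj_uniq => [|t u []//]; rewrite cat_uniq IH (uniq_plain N m.+1) andbT.
by apply/hasPn => t /(@plainP N m.+1)[_ /negbTE Ho _]; apply/negP => /mixedP[_]; rewrite Ho.
Qed.

Definition box (N : nat) : seq (seq part) := plain N N ++ mixed N N.

Lemma uniq_box N : uniq (box N).
Proof.
rewrite cat_uniq uniq_plain uniq_mixed andbT; apply/hasPn => s /mixedP[_ Ho _].
by apply/negP => /plainP[_]; rewrite Ho.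
Qed.

Lemma box_ENO N s : s \in box N -> is_ENO s.
Proof.
rewrite mem_cat is_ENOE => Hs.
have [Hb ->]: all (within N) s /\ sorted precedes s.
  by case/orP: Hs => [/plainP[]|/mixedP[]].
by rewrite andbT; apply: sub_all Hb => p /andP[].
Qed.

(** Parts are positive, so the weight bounds both their number and their sizes. Hence the boxes
    exhaust E_N^O. *)
Lemma mem_box N s : is_ENO s -> (weight s <= N)%N -> s \in box N.
Proof.
rewrite is_ENOE => /andP[Hpos Hs] Hw.
have Hsz : (size s <= N)%N.
  apply: leq_trans Hw; elim: s Hpos {Hs} => //= p s IH /andP[p0 /IH].
  by rewrite /weight /= -addn1 addnC => H; rewrite leq_add.
have Hb : all (within N) s.
  elim: s Hpos Hw {Hs Hsz} => //= p s IH /andP[p0 /IH {}IH].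
  rewrite /weight /= /within p0 /= => H.
  by rewrite (leq_trans (leq_addr _ _) H) IH // (leq_trans (leq_addl _ _) H).
rewrite mem_cat; have [Ho|Ho] := boolP (has overlined s).
  by rewrite mem_mixed // orbT.
by rewrite mem_plain.
Qed.

(** * Generating functions of the boxes *)

Arguments plain : simpl never.
Arguments mixed : simpl never.

(** The finite q-Pochhammer symbol (a; q)_n. *)
Definition poch {K : pzRingType} (a q : K) (n : nat) : K :=
  \prod_(0 <= i < n) (1 - a * q ^+ i).

Lemma poch0 (K : pzRingType) (a q : K) : poch a q 0 = 1.
Proof. by rewrite /poch big_geq. Qed.

Lemma pochS (K : pzRingType) (a q : K) n :
  poch a q n.+1 = poch a q n * (1 - a * q ^+ n).
Proof. by rewrite /poch big_nat_recr. Qed.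

Lemma pochD (K : comPzRingType) (a q : K) m n :
  poch a q (m + n) = poch a q m * poch (a * q ^+ m) q n.
Proof.
elim: n => [|n IH]; first by rewrite addn0 poch0 mulr1.
by rewrite addnS !pochS IH exprD !mulrA.
Qed.

Lemma poch_sqr (K : comPzRingType) (q : K) n :
  poch (q ^+ 2) (q ^+ 2) n = poch q q n * poch (- q) q n.
Proof.
elim: n => [|n IH]; first by rewrite !poch0 mulr1.
rewrite !pochS IH -exprM mulnC exprM; ring.
Qed.

Lemma weight_cons p s : weight (p :: s) = (part_size p + weight s)%N.
Proof. by []. Qed.

Lemma weight_cat s t : weight (s ++ t) = (weight s + weight t)%N.
Proof. by rewrite /weight map_cat sumn_cat. Qed.

Lemma weight_nseq j p : weight (nseq j p) = (part_size p * j)%N.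
Proof. by rewrite /weight map_nseq sumn_nseq. Qed.

(** The sum is a product of truncated geometric series, and (1 - q^i) sum_(j <= N) q^(ij) = 1 -
    (q^(N+1))^i for each size i. *)
Lemma sum_plain (K : comNzRingType) (q : K) N m :
  poch q q m * \sum_(s <- plain N m) q ^+ weight s =
  poch (q ^+ N.+1) (q ^+ N.+1) m.
Proof.
elim: m => [|m IH]; first by rewrite !poch0 big_seq1 mulr1.
rewrite plainS !pochS -IH.
have -> : \sum_(s <- [seq nseq j (m.+1, false) ++ t | j <- iota 0 N.+1, t <- plain N m])
    q ^+ weight s =
    (\sum_(j < N.+1) (q ^+ m.+1) ^+ j) * \sum_(s <- plain N m) q ^+ weight s.
  rewrite (@big_allpairs_dep _ _ _ _ _ _ (fun j t => nseq j (m.+1, false) ++ t)).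
  rewrite -[iota 0 N.+1]/(index_iota 0 N.+1) big_mkord mulr_suml.
  apply: eq_bigr => j _; rewrite mulr_sumr; apply: eq_bigr => s _.
  by rewrite weight_cat weight_nseq exprD exprM.
have E : (1 - q ^+ m.+1) * (\sum_(j < N.+1) (q ^+ m.+1) ^+ j) =
    1 - q ^+ N.+1 * (q ^+ N.+1) ^+ m.
  have -> : q ^+ N.+1 * (q ^+ N.+1) ^+ m = (q ^+ m.+1) ^+ N.+1.
    by rewrite -exprS -!exprM mulnC.
  by rewrite -[RHS]opprB subrX1 -mulNr opprB.
by rewrite -E -exprS; ring.
Qed.

(** Write A_m and P_m for the sums over [mixed N m] and [plain N m]. Then A_(m+1) = (1 + q^(m+1))
    A_m + q^(m+1) P_(m+1); dividing by (-q; q)_(m+1) makes this telescope, and (q; q)_k (-q; q)_k =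
    (q^2; q^2)_k. *)
Lemma sum_mixed (K : fieldType) (q : K) N m :
    (forall n, poch q q n != 0) -> (forall n, poch (- q) q n != 0) ->
  \sum_(s <- mixed N m) q ^+ weight s =
  poch (- q) q m * \sum_(k < m) q ^+ k.+1 *
    (poch (q ^+ N.+1) (q ^+ N.+1) k.+1 / poch (q ^+ 2) (q ^+ 2) k.+1).
Proof.
move=> Dn0 Fn0; elim: m => [|m IH]; first by rewrite big_nil big_ord0 mulr0.
rewrite mixedS big_cat big_map /=.
under [X in _ + X]eq_bigr => t _ do rewrite weight_cons exprD.
rewrite -mulr_sumr big_cat /= IH big_ord_recr /= poch_sqr -sum_plain.
have := Fn0 m.+1; have := Dn0 m.+1.
rewrite !(pochS _ _ _ m) => Dm Fm; set S := \sum_(i < m) _; set P := \sum_(s <- _) _.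
move: Fm Dm; rewrite !mulf_eq0 !negb_or => /andP[F1 F2] /andP[D1 D2].
by rewrite exprS; field; rewrite F1 F2 D1 D2.
Qed.

(* The Rogers-Szego polynomials satisfy
     H_(M+2) = (1 + z) H_(M+1) - z (1 - Q^(M+1)) H_M;
   [hS] is this recurrence at z = q, Q = q^2, divided by (Q; Q)_(M+1). *)
Lemma gauss_sum (K : fieldType) (q : K) M :
    (forall n, poch q q n != 0) -> (forall n, poch (- q) q n != 0) ->
  \sum_(m < M.+1) q ^+ m /
    (poch (q ^+ 2) (q ^+ 2) m * poch (q ^+ 2) (q ^+ 2) (M - m)) =
  (poch q q M)^-1.
Proof.
move=> Dn0 Fn0; pose Q := q ^+ 2; pose a n := (poch Q Q n)^-1.
have Vn0 n : poch Q Q n != 0 by rewrite poch_sqr mulf_neq0.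
have aS n : (1 - Q ^+ n.+1) * a n.+1 = a n.
  have := Vn0 n.+1; rewrite /a pochS -exprS mulf_eq0 negb_or => /andP[V0 V1].
  by field; rewrite V0.
pose h M := \sum_(m < M.+1) q ^+ m * a m * a (M - m)%N.
have hE n : \sum_(m < n.+1) q ^+ m / (poch Q Q m * poch Q Q (n - m)) = h n.
  by apply: eq_bigr => m _; rewrite invfM mulrA.
rewrite hE.
have hS n : (1 - Q ^+ n.+2) * h n.+2 = (1 + q) * h n.+1 - q * h n.
  (* With x = Q^m and y = Q^(n+2-m), 1 - xy = (1 - x) + (1 - y) - (1 - x)(1 - y). Each factor 1 -
     Q^i lowers an index of [a] by [aS] and kills the term i = 0. *)
  have -> : (1 - Q ^+ n.+2) * h n.+2 =
      \sum_(m < n.+3) q ^+ m * ((1 - Q ^+ m) * a m) * a (n.+2 - m)%N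
    + \sum_(m < n.+3) q ^+ m * a m * ((1 - Q ^+ (n.+2 - m)) * a (n.+2 - m)%N)
    - \sum_(m < n.+3)
        q ^+ m * ((1 - Q ^+ m) * a m) * ((1 - Q ^+ (n.+2 - m)) * a (n.+2 - m)%N).
    rewrite -big_split -sumrB mulr_sumr; apply: eq_bigr => m _ /=.
    have -> : Q ^+ n.+2 = Q ^+ m * Q ^+ (n.+2 - m).
      by rewrite -exprD subnKC // -ltnS.
    ring.
  have -> : \sum_(m < n.+3) q ^+ m * ((1 - Q ^+ m) * a m) * a (n.+2 - m)%N =
      q * h n.+1.
    rewrite big_ord_recl expr0 subrr mul0r mulr0 mul0r add0r mulr_sumr.
    by apply: eq_bigr => m _; rewrite lift0 aS subSS exprS !mulrA.
  have -> : \sum_(m < n.+3) q ^+ m * a m *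
      ((1 - Q ^+ (n.+2 - m)) * a (n.+2 - m)%N) = h n.+1.
    rewrite big_ord_recr /= subnn expr0 subrr mul0r mulr0 addr0.
    by apply: eq_bigr => m _; rewrite subSn -1?ltnS // aS.
  have -> : \sum_(m < n.+3) q ^+ m * ((1 - Q ^+ m) * a m) *
      ((1 - Q ^+ (n.+2 - m)) * a (n.+2 - m)%N) = q * h n.
    rewrite big_ord_recl expr0 subrr mul0r mulr0 mul0r add0r.
    rewrite big_ord_recr /= /bump /= add1n subnn expr0 subrr mul0r mulr0 addr0.
    rewrite mulr_sumr; apply: eq_bigr => m _.
    by rewrite add1n aS /= subSS subSn -1?ltnS // aS exprS !mulrA.
  ring.
(* The recurrence has order two, so the induction carries two consecutive values. *)
suff: h M = (poch q q M)^-1 /\ h M.+1 = (poch q q M.+1)^-1 by case.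
elim: M => [|M [IH0 IH1]].
  rewrite /h big_ord1 !big_ord_recr big_ord0 /= subnn subn0 /a.
  rewrite !pochS !poch0.
  have := Dn0 1; have := Fn0 1; rewrite !pochS !poch0 !mul1r !mulr1 => F1 D1.
  split; first by rewrite invr1 mulr1.
  rewrite opprK in F1.
  have Q1 : 1 - Q != 0.
    have -> : 1 - Q = (1 - q) * (1 + q) by rewrite /Q; ring.
    by rewrite mulf_neq0.
  by rewrite /Q in Q1 *; field; rewrite D1 Q1 oner_neq0.
split=> //.
have := Dn0 M.+2; have := Fn0 M.+2; rewrite !pochS !mulf_eq0 !negb_or.
move=> /andP[/andP[F0 F1] F2] /andP[/andP[D0 D1] D2].
have E : 1 - Q ^+ M.+2 = (1 - q * q ^+ M.+1) * (1 - - q * q ^+ M.+1).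
  by rewrite /Q -exprM mulnC exprM (exprS q M.+1); ring.
have QN0 : 1 - Q ^+ M.+2 != 0 by rewrite E mulf_neq0.
apply: (mulfI QN0); rewrite hS IH0 IH1 E !pochS.
rewrite (exprS q M) in D2 *; field.
by rewrite D0 D1 D2.
Qed.

(** * Error bounds *)

Lemma geo_sum_le (K : numFieldType) (r : K) n : 0 <= r < 1 ->
  \sum_(k < n) r ^+ k <= (1 - r)^-1.
Proof.
move=> /andP[r0 r1]; have r1' : 0 < 1 - r by rewrite subr_gt0.
rewrite -(ler_pM2l r1') mulfV ?gt_eqF // -opprB mulNr -subrX1 opprB.
by rewrite gerBl exprn_ge0.
Qed.

Section Estimates.
Variables (K : numFieldType) (r c : K).
Hypotheses (r0 : 0 <= r) (r1 : r < 1) (c0 : 0 < c).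
Hypothesis (cP : forall n, c <= poch r r n).

(** Each factor satisfies |1 - a q^i| >= 1 - r^(i+1), so the uniform bound [c] for (r; r)_n serves
    every such symbol. *)
Lemma poch_lb (a q : K) n : `|a| <= r -> `|q| <= r -> c <= `|poch a q n|.
Proof.
move=> ar qr; apply: le_trans (cP n) _.
elim: n => [|n IH]; first by rewrite !poch0 normr1.
rewrite !pochS normrM ler_pM //.
- exact: le_trans (ltW c0) (cP n).
- by rewrite subr_ge0 -exprS exprn_ile1 // ltW.
apply: le_trans (lerB_normD _ _); rewrite normr1 normrN lerD2l lerN2.
by rewrite normrM normrX ler_pM // ?exprn_ge0 // lerXn2r // nnegrE.
Qed.

Lemma poch_neq0 (a q : K) n : `|a| <= r -> `|q| <= r -> poch a q n != 0.
Proof. by move=> ar qr; rewrite -normr_gt0 (lt_le_trans c0) // poch_lb. Qed.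

(** Multiplied by (r; r)_n, the modulus is at most 1, since (1 + x)(1 - x) <= 1 for each x =
    r^(i+1). *)
Lemma poch_ub (a q : K) n : `|a| <= r -> `|q| <= r -> `|poch a q n| <= c^-1.
Proof.
move=> ar qr; have P0 : 0 < poch r r n by exact: lt_le_trans c0 (cP n).
apply: le_trans (_ : (poch r r n)^-1 <= _); last by rewrite lef_pV2.
rewrite -(ler_pM2r P0) mulVf ?gt_eqF //.
elim: n P0 => [|n IH] _; first by rewrite !poch0 normr1 mulr1.
have P0 : 0 < poch r r n by exact: lt_le_trans c0 (cP n).
rewrite !pochS normrM mulrACA mulr_ile1 ?IH // ?mulr_ge0 ?(ltW P0) //.
  by rewrite subr_ge0 -exprS exprn_ile1 // ltW.
have rn : r * r ^+ n <= 1 by rewrite -exprS exprn_ile1 // ltW.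
apply: le_trans (_ : (1 + r * r ^+ n) * (1 - r * r ^+ n) <= 1).
  rewrite ler_wpM2r ?subr_ge0 //.
  apply: le_trans (ler_normB _ _) _; rewrite normr1 lerD2l.
  by rewrite normrM normrX ler_pM // ?exprn_ge0 // lerXn2r // nnegrE.
have -> : (1 + r * r ^+ n) * (1 - r * r ^+ n) = 1 - (r * r ^+ n) ^+ 2 by ring.
by rewrite gerBl exprn_ge0 // mulr_ge0 // exprn_ge0.
Qed.

Definition dev : K := c^-1 / (1 - r).

Lemma dev_ge0 : 0 <= dev.
Proof. by rewrite divr_ge0 ?invr_ge0 ?(ltW c0) // subr_ge0 ltW. Qed.

Lemma poch_sub1 (a q : K) n : `|a| <= r -> `|q| <= r ->
  `|poch a q n - 1| <= dev * `|a|.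
Proof.
move=> ar qr.
have r1' : 0 < 1 - r by rewrite subr_gt0.
apply: le_trans (_ : c^-1 * `|a| * \sum_(k < n) r ^+ k <= _); last first.
  rewrite /dev [leRHS]mulrAC ler_wpM2l ?mulr_ge0 ?invr_ge0 ?(ltW c0) //.
  by apply: geo_sum_le; rewrite r0.
elim: n => [|n IH]; first by rewrite poch0 subrr normr0 big_ord0 mulr0.
rewrite pochS big_ord_recr /= [leRHS]mulrDr.
have -> : poch a q n * (1 - a * q ^+ n) - 1 =
  (poch a q n - 1) - poch a q n * a * q ^+ n by ring.
apply: le_trans (ler_normB _ _) _; rewrite lerD // !normrM normrX.
rewrite ler_pM ?mulr_ge0 ?exprn_ge0 //.
  by rewrite ler_wpM2r // poch_ub.
by rewrite lerXn2r // nnegrE.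
Qed.

Lemma poch_dist (a q : K) m n : `|a| <= r -> `|q| <= r ->
  `|poch a q (m + n) - poch a q m| <= c^-1 * dev * `|a| * `|q| ^+ m.
Proof.
move=> ar qr; rewrite pochD -[X in _ - X]mulr1 -mulrBr normrM -[leRHS]mulrA -[leRHS]mulrA.
rewrite ler_pM ?poch_ub //; apply: le_trans (poch_sub1 _ _ _ _ qr) _.
  rewrite normrM normrX (le_trans _ ar) // ler_piMr // exprn_ile1 //.
  exact: le_trans qr (ltW r1).
by rewrite normrM normrX.
Qed.

Variable (q : K).
Hypothesis (qr : `|q| = r).

Let qler : `|q| <= r. Proof. by rewrite qr. Qed.
Let Nqler : `|- q| <= r. Proof. by rewrite normrN qr. Qed.
Let q2ler : `|q ^+ 2| <= r.
Proof. by rewrite normrX qr expr2 ler_piMr // ltW. Qed.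

(** Gauss's identity writes (-q; q)_M as the same sum with weights V_M / V_(M-m). By [poch_dist]
    these differ from 1 by O(r^(2(M-m))), and r^m r^(2(M-m)) = r^M r^(M-m) leaves a geometric
    series. *)
Lemma gauss_error M :
  `|\sum_(m < M.+1) q ^+ m / poch (q ^+ 2) (q ^+ 2) m - poch (- q) q M|
  <= c^-1 ^+ 3 * dev / (1 - r) * r ^+ M.
Proof.
have Dn0 n : poch q q n != 0 by exact: poch_neq0.
have Fn0 n : poch (- q) q n != 0 by exact: poch_neq0.
pose V := poch (q ^+ 2) (q ^+ 2).
have Vn0 n : V n != 0 by exact: poch_neq0.
have Vinv n : `|(V n)^-1| <= c^-1.
  by rewrite normfV lef_pV2 ?posrE ?normr_gt0 // poch_lb.
have -> : poch (- q) q M = \sum_(m < M.+1) q ^+ m / V m * (V M / V (M - m)%N).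
  have -> : poch (- q) q M = V M * (poch q q M)^-1.
    by rewrite /V poch_sqr; field.
  rewrite -gauss_sum // mulr_sumr; apply: eq_bigr => m _.
  by rewrite -/V; field; rewrite !Vn0.
rewrite -sumrB; apply: le_trans (ler_norm_sum _ _ _) _.
apply: le_trans (_ : \sum_(m < M.+1) c^-1 ^+ 3 * dev * r ^+ M * r ^+ (M - m) <= _).
  apply: ler_sum => m _; have mM : (m <= M)%N by rewrite -ltnS.
  have -> : q ^+ m / V m - q ^+ m / V m * (V M / V (M - m)%N) =
     q ^+ m * ((V m)^-1 * (V (M - m)%N)^-1) * - (V ((M - m) + m)%N - V (M - m)%N).
    by rewrite subnK //; field; rewrite !Vn0.
  rewrite normrM normrM normrN normrX qr.
  have -> : c^-1 ^+ 3 * dev * r ^+ M * r ^+ (M - m) =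
      r ^+ m * (c^-1 * c^-1) * (c^-1 * dev * 1 * (r ^+ 2) ^+ (M - m)).
    by rewrite -{1}(subnKC mM) exprD -exprM mulnC exprM; ring.
  rewrite ler_pM ?mulr_ge0 ?exprn_ge0 //.
    by rewrite ler_wpM2l ?exprn_ge0 // normrM ler_pM.
  apply: le_trans (poch_dist _ _ _ _ q2ler q2ler) _.
  rewrite normrX qr ler_wpM2r ?exprn_ge0 // ler_wpM2l //.
    by rewrite mulr_ge0 ?dev_ge0 // invr_ge0 ltW.
  by rewrite exprn_ile1 // ltW.
rewrite -mulr_sumr (reindex_inj rev_ord_inj) /=.
under eq_bigr => m _ do rewrite subSS subKn -1?ltnS //.
rewrite [leRHS]mulrAC ler_wpM2l ?geo_sum_le ?r0 //.
by rewrite mulr_ge0 ?(mulr_ge0 _ dev_ge0) ?exprn_ge0 // invr_ge0 ltW.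
Qed.

Lemma box_error : exists C, 0 <= C /\ forall N,
  `|\sum_(s <- box N) q ^+ weight s -
    ((poch q q N)^-1 + poch (- q) q N * (poch (- q) q N - 1))| <= C * r ^+ N.
Proof.
have Dn0 n : poch q q n != 0 by exact: poch_neq0.
have Fn0 n : poch (- q) q n != 0 by exact: poch_neq0.
pose V := poch (q ^+ 2) (q ^+ 2).
have Vn0 n : V n != 0 by exact: poch_neq0.
have Vinv n : `|(V n)^-1| <= c^-1.
  by rewrite normfV lef_pV2 ?posrE ?normr_gt0 // poch_lb.
have ci0 : 0 <= c^-1 by rewrite invr_ge0 ltW.
have r1' : 0 <= (1 - r)^-1 by rewrite invr_ge0 subr_ge0 ltW.
pose W N := poch (q ^+ N.+1) (q ^+ N.+1).
have WP N k : `|W N k - 1| <= dev * r ^+ N.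
  have H : `|q ^+ N.+1| <= r.
    by rewrite normrX qr exprS ler_piMr // exprn_ile1 // ltW.
  apply: le_trans (poch_sub1 _ _ _ H H) _.
  rewrite ler_wpM2l ?dev_ge0 // normrX qr exprS ler_piMl ?exprn_ge0 //.
  exact: ltW.
(* The three terms bound the multiplicity cut-off in the plain sum, the same cut-off in the mixed
   sum, and the error in Gauss's identity. *)
exists (c^-1 * dev + c^-1 * (dev * c^-1 / (1 - r) + c^-1 ^+ 3 * dev / (1 - r))).
split; first by rewrite !(addr_ge0, mulr_ge0) ?dev_ge0 ?exprn_ge0.
move=> N; rewrite big_cat /= sum_mixed //.
have -> : \sum_(s <- plain N N) q ^+ weight s = (poch q q N)^-1 * W N N.
  by rewrite /W -sum_plain mulKf.
rewrite -/(W N) -/V.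
pose G := \sum_(m < N.+1) q ^+ m / V m.
have -> : (poch q q N)^-1 * W N N +
    poch (- q) q N * (\sum_(k < N) q ^+ k.+1 * (W N k.+1 / V k.+1)) -
    ((poch q q N)^-1 + poch (- q) q N * (poch (- q) q N - 1)) =
    (poch q q N)^-1 * (W N N - 1) + poch (- q) q N *
    (\sum_(k < N) q ^+ k.+1 * ((W N k.+1 - 1) / V k.+1) + (G - poch (- q) q N)).
  (* [G] has an extra term 1 at m = 0, while the mixed sum starts at exponent 1; this is the source
     of the -1 in the closed form. *)
  have -> : \sum_(k < N) q ^+ k.+1 * ((W N k.+1 - 1) / V k.+1) =
     \sum_(k < N) q ^+ k.+1 * (W N k.+1 / V k.+1) - (G - 1).
    rewrite /G big_ord_recl expr0 /V poch0 divr1 addrAC subrr add0r -sumrB.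
    by apply: eq_bigr => k _; rewrite lift0 mulrBl mul1r mulrBr.
  by set S := \sum_(k < N) _; ring.
rewrite mulrDl; apply: le_trans (ler_normD _ _) (lerD _ _); rewrite normrM -[leRHS]mulrA.
  rewrite ler_pM //.
  by rewrite normfV lef_pV2 ?posrE ?normr_gt0 // poch_lb.
rewrite ler_pM ?poch_ub // mulrDl.
apply: le_trans (ler_normD _ _) (lerD _ _); last exact: gauss_error.
apply: le_trans (ler_norm_sum _ _ _) _.
apply: le_trans (_ : \sum_(k < N) dev * c^-1 * r ^+ N * r ^+ k <= _).
  apply: ler_sum => k _; rewrite !normrM normrX qr mulrC.
  rewrite ler_pM ?mulr_ge0 ?exprn_ge0 //.
    by rewrite mulrAC ler_pM.
  by rewrite exprS ler_piMl ?exprn_ge0 // ltW.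
rewrite -mulr_sumr [leRHS]mulrAC ler_wpM2l ?geo_sum_le ?r0 //.
by rewrite !mulr_ge0 ?dev_ge0 ?exprn_ge0.
Qed.

End Estimates.

Local Open Scope classical_set_scope.

(** * Convergence *)

Lemma sum_fsubset (I : choiceType) (V : zmodType) (f : I -> V) (X Y : {fset I}) :
  (X `<=` Y)%fset ->
  \sum_(i <- Y) f i = \sum_(i <- X) f i + \sum_(i <- (Y `\` X)%fset) f i.
Proof.
move=> XY; rewrite (big_fsetID _ (mem X)) /=; congr (_ + _); apply: congr_big => //.
  congr (enum_fset _); apply/fsetP => i; rewrite !inE /=.
  by apply/andP/idP => [[]//|iX]; rewrite iX (fsubsetP XY).
by congr (enum_fset _); apply/fsetP => i; rewrite !inE /= andbC.
Qed.

(** If A contains [B N], some [B n] contains A, and the sum over A minus [B N] is bounded by the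
    difference of the absolute sums over [B n] and [B N]. *)
Lemma has_sum_exhaustion (I : choiceType) (K : numFieldType) (x : I -> K)
    (B : nat -> {fset I}) (l l' : K) :
    (forall A, \forall n \near \oo, (A `<=` B n)%fset) ->
    \sum_(i <- B n) x i @[n --> \oo] --> l ->
    \sum_(i <- B n) `|x i| @[n --> \oo] --> l' ->
  has_sum x l.
Proof.
move=> BA Sl Tl; have ? := @totally_filter I.
apply/cvgrPdist_lt => e e0.
have e3 : 0 < e / 3 by rewrite divr_gt0.
move/cvgrPdist_lt/(_ _ e3) : Sl => [N1 _ H1].
move/cvgrPdist_lt/(_ _ e3) : Tl => [N2 _ H2].
pose N := maxn N1 N2.
have {}H1 : `|l - \sum_(i <- B N) x i| < e / 3 by apply: H1 => /=; exact: leq_maxl.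
exists (B N) => // A /= BNA.
have [n0 _ Hn0] := BA A; pose n := maxn n0 N2.
have AB : (A `<=` B n)%fset by apply: Hn0 => /=; exact: leq_maxl.
have HN : `|l' - \sum_(i <- B N) `|x i| | < e / 3 by apply: H2 => /=; exact: leq_maxr.
have Hn : `|l' - \sum_(i <- B n) `|x i| | < e / 3 by apply: H2 => /=; exact: leq_maxr.
rewrite /partial_sum -(big_seq_fsetE _ _ xpredT) /= (sum_fsubset _ _ _ _ _ BNA) opprD addrA.
apply: le_lt_trans (ler_normB _ _) _.
have -> : e = e / 3 + (e / 3 + e / 3) by field.
rewrite ltrD //; apply: le_lt_trans (_ : \sum_(i <- (B n `\` B N)%fset) `|x i| < _).
  apply: le_trans (ler_norm_sum _ _ _) _.
  have sub : (A `\` B N `<=` B n `\` B N)%fset by exact: fsetSD.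
  by rewrite [leRHS](sum_fsubset _ _ _ _ _ sub) lerDl sumr_ge0.
have BB := fsubset_trans BNA AB.
have -> : \sum_(i <- (B n `\` B N)%fset) `|x i| =
   `|(l' - \sum_(i <- B N) `|x i|) - (l' - \sum_(i <- B n) `|x i|)|.
  rewrite (sum_fsubset _ _ _ _ _ BB) opprB addrC addrA subrK addrAC subrr add0r.
  by rewrite ger0_norm // sumr_ge0.
by apply: le_lt_trans (ler_normB _ _) _; rewrite ltrD.
Qed.

Definition box_fset (N : nat) : {fset ENO} :=
  [fset x : ENO in pmap insub (box N)]%fset.

Lemma sum_box_fset (V : zmodType) (f : seq part -> V) N :
  \sum_(i <- box_fset N) f (val i) = \sum_(s <- box N) f s.
Proof.
have P : perm_eq (box_fset N) (pmap insub (box N) : seq ENO).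
  apply: uniq_perm; rewrite ?fset_uniq ?pmap_sub_uniq ?uniq_box //.
  by move=> i; rewrite !inE.
rewrite (perm_big _ P) big_pmap; apply: eq_big_seq => s /box_ENO Hs.
by rewrite insubT.
Qed.

Lemma box_fset_cofinal (A : {fset ENO}) : \forall n \near \oo, (A `<=` box_fset n)%fset.
Proof.
exists (\sum_(i <- A) weight (val i))%N => // n /= Hn.
apply/fsubsetP => i iA; rewrite !inE mem_pmap_sub mem_box ?(valP i) //.
by apply: leq_trans Hn; rewrite (big_rem i) //= leq_addr.
Qed.

(** A [numFieldType] may be non-Archimedean, so |r| < 1 alone does not give this. *)
Definition vanishing (K : numFieldType) (r : K) : Prop :=
  forall e, 0 < e -> exists N, forall n, (N <= n)%N -> r ^+ n < e.

Lemma vanishing_cvg (K : numFieldType) (r C : K) (u : nat -> K) (l : K) :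
    vanishing _ r -> 0 <= C -> (forall n, `|l - u n| <= C * r ^+ n) ->
  u n @[n --> \oo] --> l.
Proof.
move=> vr C0 H; apply/cvgrPdist_lt => e e0.
(* [C] may be 0, so the division is by C + 1. *)
have C1 : 0 < C + 1 by rewrite ltr_wpDl.
have [N HN] := vr (e / (C + 1)) (divr_gt0 e0 C1).
exists N => // n /= /HN Hn; apply: le_lt_trans (H n) _.
apply: le_lt_trans (_ : C * (e / (C + 1)) < _); first by rewrite ler_wpM2l // ltW.
by rewrite mulrCA gtr_pMr // ltr_pdivrMr // mul1r ltrDl.
Qed.

Lemma qpoch_inf_lim (K : numFieldType) (a q l : K) :
  poch a q n @[n --> \oo] --> l -> qpoch_inf a q = l.
Proof. by move=> H; apply: cvg_lim => //; exact: norm_hausdorff. Qed.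

Lemma box_cvg (K : numFieldType) (q c D F : K) :
    `|q| < 1 -> vanishing _ `|q| ->
    0 < c -> (forall n, c <= poch `|q| `|q| n) ->
    poch q q n @[n --> \oo] --> D -> poch (- q) q n @[n --> \oo] --> F ->
  \sum_(s <- box n) q ^+ weight s @[n --> \oo] --> F ^+ 2 + D^-1 - F.
Proof.
move=> q1 vq c0 cP HD HF.
have [E [E0 HE]] := box_error _ _ _ (normr_ge0 q) q1 c0 cP q erefl.
(* The lower bound [c] survives in the limit, so inversion is continuous at [D]. *)
have D0 : D != 0.
  apply/eqP => D0; move/cvgrPdist_lt/(_ _ c0) : HD => [N _ /(_ N (leqnn N))].
  rewrite D0 sub0r normrN => /lt_geF.
  by rewrite (poch_lb _ _ _ (normr_ge0 q) q1 c0 cP).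
have HL : (poch q q n)^-1 + poch (- q) q n * (poch (- q) q n - 1) @[n --> \oo]
    --> D^-1 + F * (F - 1).
  apply: cvgD; first exact: cvgV.
  by apply: cvgM => //; apply: cvgB => //; exact: cvg_cst.
have -> : F ^+ 2 + D^-1 - F = 0 + (D^-1 + F * (F - 1)) by ring.
have H0 : \sum_(s <- box n) q ^+ weight s -
    ((poch q q n)^-1 + poch (- q) q n * (poch (- q) q n - 1)) @[n --> \oo] --> (0 : K).
  apply: (vanishing_cvg _ _ _ _ _ vq E0) => n.
  by rewrite sub0r normrN.
apply: cvg_trans (cvgD H0 HL); apply: near_eq_cvg; near=> n.
by rewrite /= subrK.
Unshelve. all: by end_near.
Qed.

Lemma ENO_has_sum (K : numFieldType) (q c : K) :
    `|q| < 1 -> vanishing _ `|q| ->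
    0 < c -> (forall n, c <= poch `|q| `|q| n) ->
    (forall a p : K, `|a| <= `|q| -> `|p| = `|q| ->
      exists l : K, poch a p n @[n --> \oo] --> l) ->
  has_sum (fun pi : ENO => q ^+ weight (val pi))
    (qpoch_inf (- q) q ^+ 2 + (qpoch_inf q q)^-1 - qpoch_inf (- q) q).
Proof.
move=> q1 vq c0 cP pcvg.
have [D HD] := pcvg q q (lexx _) erefl.
have [|//|F HF] := pcvg (- q) q; first by rewrite normrN.
rewrite (qpoch_inf_lim _ _ _ _ HD) (qpoch_inf_lim _ _ _ _ HF).
have [||D' HD'] := pcvg `|q| `|q|; rewrite ?normr_id //.
have [||F' HF'] := pcvg (- `|q|) `|q|; rewrite ?normrN ?normr_id //.
(* The absolute sums are the same box sums taken at |q|, so [box_cvg] gives both limits. *)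
apply: (has_sum_exhaustion _ _ _ box_fset _ (F' ^+ 2 + D'^-1 - F') box_fset_cofinal).
  under eq_fun => n do rewrite (sum_box_fset _ (fun s => q ^+ weight s)).
  exact: (box_cvg _ _ c).
under eq_fun => n do under eq_bigr => i _ do rewrite normrX.
under eq_fun => n do rewrite (sum_box_fset _ (fun s => `|q| ^+ weight s)).
by apply: (box_cvg _ _ c); rewrite ?normr_id.
Qed.

(** * Lower bound, vanishing powers and completeness for the complex numbers *)

Section Complex.
Variable R : realType.
Local Notation "x %:C" := (real_complex R x).

(** For x = r^(n+1), 1 / (1 - x) = 1 + x / (1 - x) <= exp(r^n / (1 - r)); the exponents sum to at
    most (1 - r)^-2. *)
Lemma poch_lower_bound (r : R) : 0 <= r < 1 ->
  exists2 c, 0 < c & forall n, c <= poch r r n.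
Proof.
move=> /andP[r0 r1]; have r1' : 0 < 1 - r by rewrite subr_gt0.
exists (expR (- ((1 - r)^-1 / (1 - r)))); first exact: expR_gt0.
move=> n; apply: le_trans (_ : expR (- ((1 - r)^-1 * \sum_(k < n) r ^+ k)) <= _).
  by rewrite ler_expR lerN2 ler_wpM2l ?geo_sum_le ?r0 // invr_ge0 ltW.
elim: n => [|n IH]; first by rewrite big_ord0 mulr0 oppr0 expR0 poch0.
rewrite big_ord_recr /= mulrDr opprD expRD pochS ler_pM ?expR_ge0 //.
rewrite expRN -exprS.
have x1 : r ^+ n.+1 <= r by rewrite exprS ler_piMr // exprn_ile1 // ltW.
have x0 : 0 <= r ^+ n.+1 by rewrite exprn_ge0.
have x1' : 0 < 1 - r ^+ n.+1 by rewrite subr_gt0 (le_lt_trans x1).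
rewrite -[leRHS]invrK lef_pV2 ?posrE ?expR_gt0 ?invr_gt0 //.
apply: le_trans (expR_ge1Dx _).
have -> : (1 - r ^+ n.+1)^-1 = 1 + (1 - r ^+ n.+1)^-1 * r ^+ n.+1.
  by field; rewrite gt_eqF.
rewrite lerD2l ler_pM ?invr_ge0 ?(ltW x1') //.
  by rewrite lef_pV2 // lerD2l lerN2.
by rewrite exprS ler_piMl ?exprn_ge0 // ltW.
Qed.

Lemma ge0_real (z : R[i]) : 0 <= z -> z = (complex.Re z)%:C.
Proof. by case: z => a b; rewrite lecE /= => /andP[/eqP -> _]. Qed.

Lemma normc_real_abs (x : R) : `|x%:C| = `|x|%:C.
Proof. by rewrite normc_def /= expr0n addr0 sqrtr_sqr. Qed.

Lemma normci : `|'i%C : R[i]| = 1.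
Proof. by rewrite normc_def /= expr0n expr1n add0r sqrtr1. Qed.

Lemma normc_ge_Re (z : R[i]) : `|complex.Re z|%:C <= `|z|.
Proof.
by rewrite normc_def lecR -sqrtr_sqr ler_sqrt ?addr_ge0 ?sqr_ge0 // lerDl sqr_ge0.
Qed.

Lemma normc_ge_Im (z : R[i]) : `|complex.Im z|%:C <= `|z|.
Proof.
by rewrite normc_def lecR -sqrtr_sqr ler_sqrt ?addr_ge0 ?sqr_ge0 // lerDr sqr_ge0.
Qed.

Lemma complex_vanishing (r : R[i]) : 0 <= r < 1 -> vanishing _ r.
Proof.
move=> /andP[r0 r1] e e0; have rE := ge0_real _ r0; have eE := ge0_real _ (ltW e0).
move: r0 r1 e0; rewrite {}rE {}eE !ltcR lecR.
move: (complex.Re r) (complex.Re e) => {}r {}e r0 r1 e0.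
have /cvg_expr : `|r| < 1 by rewrite ger0_norm.
move/cvgrPdist_lt/(_ _ e0) => [N _ HN]; exists N => n /HN.
by rewrite /= sub0r normrN ger0_norm ?exprn_ge0 // -rmorphXn ltcR.
Qed.

Lemma complex_poch_lower_bound (r : R[i]) : 0 <= r < 1 ->
  exists2 c, 0 < c & forall n, c <= poch r r n.
Proof.
move=> /andP[r0 r1]; have rE := ge0_real _ r0.
move: r0 r1; rewrite {}rE ltcR lecR.
move: (complex.Re r) => {}r r0 r1.
have [|c c0 Hc] := poch_lower_bound r; first by rewrite r0.
exists c%:C => [|n]; first by rewrite ltcR.
have -> : poch r%:C r%:C n = (poch r r n)%:C.
  rewrite /poch rmorph_prod; apply: eq_bigr => i _.
  by rewrite rmorphB rmorphM rmorphXn rmorph1.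
by rewrite lecR.
Qed.

Lemma real_geometric_cauchy (r C : R) (u : nat -> R) : 0 <= r < 1 -> 0 <= C ->
    (forall m n, `|u (m + n)%N - u m| <= C * r ^+ m) ->
  exists l, forall m, `|l - u m| <= C * r ^+ m.
Proof.
move=> /andP[r0 r1] C0 H.
have r1n : `|r| < 1 by rewrite ger0_norm.
have Cr : C * r ^+ n @[n --> \oo] --> 0.
  by rewrite -(mulr0 C); apply: cvgM; [exact: cvg_cst|exact: cvg_expr].
have : cvg (u n @[n --> \oo]).
  apply/cauchy_cvgP/cauchy_exP => e e0.
  move/cvgrPdist_lt/(_ _ e0) : Cr => [N _ /(_ N (leqnn N))].
  rewrite /= sub0r normrN => HN.
  exists (u N); exists N => // n /= Nn; rewrite /ball /= distrC -(subnKC Nn).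
  exact: le_lt_trans (H _ _) (le_lt_trans (ler_norm _) HN).
move=> /cvg_ex[/= l Hl]; exists l => m; apply/ler_addgt0Pr => e e0.
move/cvgrPdist_lt/(_ _ e0) : Hl => [N _ /(_ (m + N)%N (leq_addl _ _))] HN.
rewrite -(subrK (u (m + N)%N) l) -addrA addrC.
by apply: le_trans (ler_normD _ _) (lerD (H _ _) (ltW HN)).
Qed.

(** Real and imaginary parts converge separately, each within C r^m; adding the two errors gives the
    factor 2. *)
Lemma complex_geometric_cauchy (r C : R[i]) (u : nat -> R[i]) :
    0 <= r < 1 -> 0 <= C ->
    (forall m n, `|u (m + n)%N - u m| <= C * r ^+ m) ->
  exists l, forall m, `|l - u m| <= 2 * C * r ^+ m.
Proof.
move=> /andP[r0 r1] C0; have rE := ge0_real _ r0; have CE := ge0_real _ C0.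
move: r0 r1 C0; rewrite {}rE {}CE ltcR !lecR.
move: (complex.Re r) (complex.Re C) => {}r {}C r0 r1 C0 H.
have r01 : 0 <= r < 1 by rewrite r0.
have HC m : C%:C * r%:C ^+ m = (C * r ^+ m)%:C by rewrite rmorphM rmorphXn.
have [|a Ha] := real_geometric_cauchy r C (fun n => complex.Re (u n)) r01 C0.
  move=> m n; rewrite -lecR -HC; apply: le_trans (H m n).
  by rewrite -raddfB normc_ge_Re.
have [|b Hb] := real_geometric_cauchy r C (fun n => complex.Im (u n)) r01 C0.
  move=> m n; rewrite -lecR -HC; apply: le_trans (H m n).
  by rewrite -raddfB normc_ge_Im.
exists (Complex a b) => m; rewrite -mulrA HC mulr2n mulrDl mul1r.
have -> : Complex a b - u m =
    (a - complex.Re (u m))%:C + 'i%C * (b - complex.Im (u m))%:C.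
  by case: (u m) => x y; simpc.
apply: le_trans (ler_normD _ _) (lerD _ _).
  by rewrite normc_real_abs lecR.
by rewrite normrM normci mul1r normc_real_abs lecR.
Qed.

End Complex.


Theorem mainTheorem6 (R : realType) (q : R[i]) (hq : `|q| < 1) :
  has_sum (fun pi : ENO => q ^+ weight (val pi))
    (qpoch_inf (- q) q ^+ 2 + (qpoch_inf q q)^-1 - qpoch_inf (- q) q).
Proof.
have q0 := normr_ge0 q.
have q01 : 0 <= `|q| < 1 by rewrite q0.
have vq := complex_vanishing _ _ q01.
have [c c0 cP] := complex_poch_lower_bound _ _ q01.
apply: (ENO_has_sum _ _ c) => // a p ap pq.
have ple : `|p| <= `|q| by rewrite pq.
have C0 : 0 <= c^-1 * dev _ `|q| c * `|q|.
  by rewrite mulr_ge0 // mulr_ge0 ?dev_ge0 // invr_ge0 ltW.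
(* The geometric estimate [poch_dist] makes the partial products Cauchy. *)
have [|l Hl] := complex_geometric_cauchy _ _ _ (poch a p) q01 C0.
  move=> m n; apply: le_trans (poch_dist _ _ _ q0 hq c0 cP _ _ _ _ ap ple) _.
  rewrite pq ler_wpM2r ?exprn_ge0 // ler_wpM2l //.
  by rewrite mulr_ge0 ?dev_ge0 // invr_ge0 ltW.
by exists l; apply: (vanishing_cvg _ _ _ _ _ vq _ Hl); rewrite mulr_ge0.
Qed.
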